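(* Let $0<p<1$. Then the set \[ \mathcal{L}(\ell_p;\ell_p)\setminus \bigcup_{1\le s\le r<\infty}\Pi_{(r,s)}(\ell_p;\ell_p) \] is $\mathfrak{c}$-lineable, i.e. there is a linear subspace of $\mathcal{L}(\ell_p;\ell_p)$ of dimension $\mathfrak{c}$ all of whose nonzero elements are bounded linear operators $\ell_p\to\ell_p$ that are not absolutely $(r,s)$-summing for any real numbers $r,s$ with $1\le s\le r<\infty$. Moreover, the analogous statement fails for every $p\ge 1$: for $p\ge1$ (with $\ell_p$ the usual Banach space) one has $\mathcal{L}(\ell_p;\ell_p)\setminus \bigcup_{1\le s\le r<\infty}\Pi_{(r,s)}(\ell_p;\ell_p)=\emptyset$.
   Context: For $0<p<1$, $\ell_p$ is the space of scalar sequences $x=(x_k)$ with $\|x\|_p=(\sum_k|x_k|^p)^{1/p}<\infty$ (a $p$-Banach, non-locally convex space); for $p\ge1$ it is the usual Banach space. $\mathcal{L}(E;F)$ denotes the space of bounded linear operators from $E$ to $F$. For $p$-normed spaces $E,F$ whose topological dual $E'$ is nontrivial (e.g. $E=\ell_p$, $0<p<1$) and $1\le s\le r<\infty$, a linear operator $T:E\to F$ is absolutely $(r,s)$-summing if $\sum_k\|T(x_k)\|^r<\infty$ whenever $(x_k)_{k=1}^\infty$ is a sequence in $E$ such that $\sum_k|f(x_k)|^s<\infty$ for every $f\in E'$; $\Pi_{(r,s)}(E;F)$ denotes the set of such operators. A subset $A$ of a vector space is $\mu$-lineable if $A\cup\{0\}$ contains a linear subspace of dimension $\mu$. $\mathfrak{c}$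 denotes the cardinality of $\mathbb{R}$. Scalars are $\mathbb{K}=\mathbb{R}$ or $\mathbb{C}$. *)

(* Defs.v *)
From HB Require Import structures.
From mathcomp Require Import all_boot all_order all_algebra.
From mathcomp Require Import all_classical all_reals all_analysis.
From mathcomp Require complex.
Import complex.ComplexField.
Set Implicit Arguments. Unset Strict Implicit. Unset Printing Implicit Defensive.
Import Order.TTheory GRing.Theory Num.Theory.
Import numFieldNormedType.Exports.
Local Open Scope ring_scope.

(* Scalars: a number field K together with its absolute value |.| : K -> R.
   Used with (K, ab) = (R, normr) (real scalars) and (R[i], cabs) (complex). *)

Definition cabs (R : realType) (z : complex.complex R) : R :=
  Num.sqrt (complex.Re z ^+ 2 + complex.Im z ^+ 2).

Definition sumfin (R : realType) (u : nat -> R) : Prop :=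
  (\sum_(0 <= k <oo) (u k)%:E < +oo)%E.

Section Lp.
Variables (R : realType) (K : numFieldType) (ab : K -> R) (p : R).

Definition in_lp (x : nat -> K) : Prop := sumfin (fun k => ab (x k) `^ p).

Definition lpnorm (x : nat -> K) : R :=
  (fine (\sum_(0 <= k <oo) (ab (x k) `^ p)%:E)%E) `^ (p^-1).

Definition seq_add (x y : nat -> K) : nat -> K := fun k => x k + y k.
Definition seq_scale (a : K) (x : nat -> K) : nat -> K := fun k => a * x k.
Definition seq_sub (x y : nat -> K) : nat -> K := fun k => x k - y k.

(* T is an element of L(ell_p; ell_p): maps ell_p into ell_p, is linear and
   bounded on ell_p (only its restriction to ell_p matters). *)
Definition bounded_op (T : (nat -> K) -> (nat -> K)) : Prop :=
  (forall x, in_lp x -> in_lp (T x)) /\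
  (forall (a : K) x y, in_lp x -> in_lp y ->
     T (seq_add (seq_scale a x) y) = seq_add (seq_scale a (T x)) (T y)) /\
  (exists C : R, forall x, in_lp x -> lpnorm (T x) <= C * lpnorm x).

Definition in_dual (f : (nat -> K) -> K) : Prop :=
  (forall (a : K) x y, in_lp x -> in_lp y ->
     f (seq_add (seq_scale a x) y) = a * f x + f y) /\
  (forall x, in_lp x -> forall eps : R, 0 < eps -> exists2 delta : R, 0 < delta &
     forall y, in_lp y -> lpnorm (seq_sub y x) < delta -> ab (f y - f x) < eps).

Definition abs_summing (r s : R) (T : (nat -> K) -> (nat -> K)) : Prop :=
  forall xs : nat -> nat -> K, (forall k, in_lp (xs k)) ->
    (forall f, in_dual f -> sumfin (fun k => ab (f (xs k)) `^ s)) ->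
    sumfin (fun k => lpnorm (T (xs k)) `^ r).

Definition nowhere_summing (T : (nat -> K) -> (nat -> K)) : Prop :=
  bounded_op T /\ forall r s : R, 1 <= s -> s <= r -> ~ abs_summing r s T.

Definition lincomb (I : eqType) (Tf : I -> (nat -> K) -> (nat -> K))
  (S : seq I) (c : I -> K) : (nat -> K) -> (nat -> K) :=
  fun x k => \sum_(i <- S) c i * Tf i x k.

(* c-lineability of the set above: a family (T_i)_{i in R} (R has cardinality
   continuum) whose every nontrivial finite linear combination is a nonzero
   element of L(ell_p;ell_p) (so the family is linearly independent and spans
   a subspace of dimension c) lying in the set. *)
Definition c_lineable_nowhere_summing : Prop :=
  exists Tf : R -> (nat -> K) -> (nat -> K),
    forall (S : seq R) (c : R -> K), uniq S -> (exists2 i, i \in S & c i != 0) ->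
      (exists x, in_lp x /\ exists k, lincomb Tf S c x k != 0) /\
      nowhere_summing (lincomb Tf S c).

Definition every_op_summing : Prop :=
  forall T, bounded_op T ->
    exists r s : R, [/\ 1 <= s, s <= r & abs_summing r s T].

End Lp.

(* Main.v *)
(* For [p < 1] the dual of [l_p] is [l_infinity], so averages of [N] unit vectors
   scaled by [2^-n] form a weakly summable sequence, while their quasi-norms
   [N^(1/p-1) 2^-n] stay at least [1] for suitable [N = N_n].  Multiplications
   by indicators of an almost disjoint family of continuum many subsets of [nat],
   each containing infinitely many whole blocks, have linear combinations acting
   on almost all blocks of a chosen subset as a nonzero scalar.
   For [p >= 1] every weakly summable [(x_k)] in [l_p] satisfies
   [sum_k ||x_k||^(2p) < oo]: the signed partial sums are weakly bounded, hence
   norm bounded (uniform boundedness), and averaging over signs (Khintchine)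
   puts the square function [(sum_k |x_k(j)|^2)^(1/2)] in [l_p]; Cauchy-Schwarz
   concludes.  As [f o T] is in the dual whenever [f] is, every bounded operator
   is [(2p, 1)]-summing. *)
Require Import Defs.
From HB Require Import structures.
From mathcomp Require Import all_boot all_order all_algebra.
From mathcomp Require Import all_classical all_reals all_analysis.
From mathcomp Require complex.
From mathcomp Require Import ring lra.
Set Implicit Arguments. Unset Strict Implicit. Unset Printing Implicit Defensive.
Import complex.ComplexField.
Import Order.TTheory GRing.Theory Num.Theory.
Local Open Scope ring_scope.

(** * Nonnegative series *)

Section NonnegativeSeries.
Context {R : realType}.
Implicit Types u v : nat -> R.

(** As [fine] sends [+oo] to 0, a divergent series gets the value 0; lemmas on this value therefore
    carry [sumfin]. *)
Definition tsum (u : nat -> R) : R := fine (\sum_(0 <= k <oo) (u k)%:E)%E.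

Lemma sumfin_fineK u : (forall k, 0 <= u k) -> sumfin u ->
  (\sum_(0 <= k <oo) (u k)%:E)%E = (tsum u)%:E.
Proof.
move=> u0 su; rewrite /tsum fineK// ge0_fin_numE//.
by apply: nneseries_ge0 => k _ _; rewrite lee_fin.
Qed.

Lemma partial_le_tsum u n : (forall k, 0 <= u k) -> sumfin u ->
  \sum_(0 <= k < n) u k <= tsum u.
Proof.
move=> u0 su; rewrite -lee_fin -(sumfin_fineK u0 su) -sumEFin.
by apply: nneseries_lim_ge => k _ _; rewrite lee_fin.
Qed.

Lemma tsum_bounded u M : (forall k, 0 <= u k) ->
  (forall n, \sum_(0 <= k < n) u k <= M) -> sumfin u /\ tsum u <= M.
Proof.
move=> u0 uM.
have uMe : (\sum_(0 <= k <oo) (u k)%:E <= M%:E)%E.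
  apply: lime_le; first by apply: is_cvg_nneseries => k _ _; rewrite lee_fin.
  by apply: nearW => n; rewrite sumEFin lee_fin.
have su : sumfin u by apply: le_lt_trans uMe _; rewrite ltry.
by split=> //; rewrite -lee_fin -(sumfin_fineK u0 su).
Qed.

Lemma tsum_ge0 u : (forall k, 0 <= u k) -> 0 <= tsum u.
Proof.
by move=> u0; apply: fine_ge0; apply: nneseries_ge0 => k _ _; rewrite lee_fin.
Qed.

Lemma sumfin_le u v : (forall k, 0 <= u k) -> (forall k, u k <= v k) ->
  sumfin v -> sumfin u /\ tsum u <= tsum v.
Proof.
move=> u0 uv sv; apply: tsum_bounded => // n.
have v0 k : 0 <= v k by exact: le_trans (uv k).
by apply: le_trans (partial_le_tsum n v0 sv); exact: ler_sum.
Qed.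

Lemma sumfinD u v : (forall k, 0 <= u k) -> (forall k, 0 <= v k) ->
  sumfin u -> sumfin v ->
  sumfin (fun k => u k + v k) /\ tsum (fun k => u k + v k) = tsum u + tsum v.
Proof.
move=> u0 v0 su sv.
have E : (\sum_(0 <= k <oo) (u k + v k)%:E)%E = (tsum u + tsum v)%:E.
  under eq_eseriesr do rewrite EFinD.
  rewrite nneseriesD; [|by move=> *; rewrite lee_fin ..].
  by rewrite !sumfin_fineK.
by split; rewrite /sumfin /tsum E// ltry.
Qed.

Lemma sumfinZ c u : 0 <= c -> (forall k, 0 <= u k) -> sumfin u ->
  sumfin (fun k => c * u k) /\ tsum (fun k => c * u k) = c * tsum u.
Proof.
move=> c0 u0 su.
have E : (\sum_(0 <= k <oo) (c * u k)%:E)%E = (c * tsum u)%:E.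
  under eq_eseriesr do rewrite EFinM.
  rewrite nneseriesZl; last by move=> *; rewrite lee_fin.
  by rewrite sumfin_fineK.
by split; rewrite /sumfin /tsum E// ltry.
Qed.

Lemma tsum_single (u : nat -> R) (j : nat) :
  (forall k, 0 <= u k) -> (forall k, k != j -> u k = 0) ->
  sumfin u /\ tsum u = u j.
Proof.
move=> u0 uj.
have E n : (j < n)%N -> \sum_(0 <= k < n) u k = u j.
  move=> jn; rewrite (bigD1_seq j)/= ?mem_index_iota ?iota_uniq//.
  by rewrite big1 ?addr0// => k /uj.
have bd n : \sum_(0 <= k < n) u k <= u j.
  have [jn|nj] := ltnP j n; first by rewrite E.
  rewrite big_nat big1// => k /andP[_ kn]; apply: uj.
  by rewrite ltn_eqF// (leq_trans kn).
have [su le] := tsum_bounded u0 bd; split=> //.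
by apply/le_anti; rewrite le//= -(E j.+1)// partial_le_tsum.
Qed.

(** Otherwise every partial sum is at most half the total, hence so is the total, which then
    vanishes; [n = 0] contradicts this. This is how infinite sums are cut to finite ones below. *)
Lemma tsum_ge_half u : (forall k, 0 <= u k) -> sumfin u ->
  exists n, tsum u <= 2 * \sum_(0 <= k < n) u k.
Proof.
move=> u0 su; apply: contrapT => /forallNP H.
have bd n : \sum_(0 <= k < n) u k <= tsum u / 2.
  by have /negP := H n; rewrite -ltNge => ?; lra.
have [_ h] := tsum_bounded u0 bd.
have /negP := H 0; rewrite big_nil; have := tsum_ge0 u0; lra.
Qed.

Lemma sumfin_not_bounded_below u n0 c : (forall k, 0 <= u k) -> 0 < c ->
  (forall n, (n0 <= n)%N -> c <= u n) -> ~ sumfin u.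
Proof.
move=> u0 c0 cu su.
have cS m : c * m%:R <= tsum u.
  apply: le_trans (partial_le_tsum (n0 + m) u0 su).
  rewrite (@big_cat_nat _ _ _ n0)//= ?leq_addr//.
  apply: (@le_trans _ _ (\sum_(n0 <= i < n0 + m) c)).
    by rewrite sumr_const_nat addKn mulr_natr.
  rewrite -[leLHS]add0r lerD ?sumr_ge0//.
  by apply: ler_sum_nat => k /andP[+ _]; exact: cu.
have := cS (Num.bound (tsum u / c)).
rewrite leNgt => /negP; apply; rewrite mulrC -ltr_pdivrMr//.
by apply: archi_boundP; rewrite divr_ge0 ?tsum_ge0 // ltW.
Qed.

End NonnegativeSeries.

(** * Sequence spaces over the real or complex scalars *)

(** Common interface to the real and complex scalars. The parallelogram law drives the moment
    computations for sign sums, completeness gives the limit of a sequence of functionals. *)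
Record is_modulus {R : realType} {K : numFieldType} (ab : K -> R)
    (emb : {rmorphism R -> K}) : Prop := IsModulus {
  modM : forall x y, ab (x * y) = ab x * ab y;
  modD : forall x y, ab (x + y) <= ab x + ab y;
  mod_eq0 : forall x, ab x = 0 -> x = 0;
  mod_parallelogram : forall x y,
    ab (x + y) ^+ 2 + ab (x - y) ^+ 2 = 2 * (ab x ^+ 2 + ab y ^+ 2);
  mod_emb : forall r, ab (emb r) = `|r|;
  mod_complete : forall u : nat -> K,
    (forall e, 0 < e -> exists N, forall n, (N <= n)%N -> ab (u n - u N) < e) ->
    exists l, forall e, 0 < e -> exists N, forall n, (N <= n)%N ->
      ab (u n - l) < e }.

Section LpSpace.
Context {R : realType} {K : numFieldType} {ab : K -> R}
  {emb : {rmorphism R -> K}} (abP : is_modulus ab emb).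
Implicit Types (x y : nat -> K) (a b : K).

Local Notation abM := (modM abP).
Local Notation abD := (modD abP).

Lemma mod0 : ab 0 = 0.
Proof. by rewrite -(rmorph0 emb) (mod_emb abP) normr0. Qed.

Lemma mod1 : ab 1 = 1.
Proof. by rewrite -(rmorph1 emb) (mod_emb abP) normr1. Qed.

Lemma modN a : ab (- a) = ab a.
Proof.
by rewrite -mulN1r -(rmorphN1 emb) abM (mod_emb abP) normrN1 mul1r.
Qed.

Lemma mod_ge0 a : 0 <= ab a.
Proof. by have := abD a (- a); rewrite subrr mod0 modN; lra. Qed.

Lemma mod_gt0 a : a != 0 -> 0 < ab a.
Proof.
move=> a0; rewrite lt_neqAle mod_ge0 andbT eq_sym.
by apply: contra_neq a0; exact: mod_eq0 abP a.
Qed.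

Lemma modB a b : ab (a - b) <= ab a + ab b.
Proof. by rewrite -(modN b) abD. Qed.

Lemma modBC a b : ab (a - b) = ab (b - a).
Proof. by rewrite -modN opprB. Qed.

Lemma mod_le_sub a b : ab a <= ab b + ab (a - b).
Proof. by have := abD b (a - b); rewrite addrC subrK. Qed.

Lemma mod_sum (I : Type) (s : seq I) (P : pred I) (F : I -> K) :
  ab (\sum_(i <- s | P i) F i) <= \sum_(i <- s | P i) ab (F i).
Proof.
elim/big_rec2: _ => [|i r z _ zr]; first by rewrite mod0.
by apply: le_trans (abD _ _) _; rewrite lerD2l.
Qed.

Context {p : R} (p0 : 0 < p).

Local Notation lpn := (lpnorm ab p).
Local Notation lp := (in_lp ab p).

Definition psum x : R := tsum (fun k => ab (x k) `^ p).

Lemma psum_ge0 x : 0 <= psum x.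
Proof. by apply: tsum_ge0 => k; exact: powR_ge0. Qed.

Lemma lpn_ge0 x : 0 <= lpn x. Proof. exact: powR_ge0. Qed.

Lemma lpnX x : lpn x `^ p = psum x.
Proof. by rewrite -powRrM mulVf ?gt_eqF// powRr1// psum_ge0. Qed.

Lemma lpn_le x (M : R) : 0 <= M -> (lpn x <= M) = (psum x <= M `^ p).
Proof.
move=> M0; rewrite -lpnX; apply/idP/idP => h.
  by apply: ge0_ler_powR; rewrite ?nnegrE ?lpn_ge0 ?(ltW p0).
rewrite leNgt; apply/negP => lt; move: h; rewrite leNgt => /negP; apply.
by apply: gt0_ltr_powR; rewrite ?nnegrE ?lpn_ge0.
Qed.

Lemma lpn_psum_eq x (M : R) : 0 <= M -> psum x = M `^ p -> lpn x = M.
Proof.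
move=> M0 h.
by rewrite -[lpn x]/(psum x `^ p^-1) h -powRrM mulfV ?gt_eqF// powRr1.
Qed.

Lemma partial_le_psum x n : lp x -> \sum_(0 <= k < n) ab (x k) `^ p <= psum x.
Proof. by move=> lx; apply: partial_le_tsum => // k; exact: powR_ge0. Qed.

Lemma psum_bounded x M : (forall n, \sum_(0 <= k < n) ab (x k) `^ p <= M) ->
  lp x /\ psum x <= M.
Proof. by move=> h; apply: tsum_bounded => // k; exact: powR_ge0. Qed.

Lemma coord_le_lpn x k : lp x -> ab (x k) <= lpn x.
Proof.
move=> lx; rewrite leNgt; apply/negP => lt.
have := partial_le_psum k.+1 lx; rewrite big_nat_recr//= leNgt => /negP; apply.
rewrite -lpnX -[ltLHS]add0r ler_ltD ?sumr_ge0// => [i _|]; first exact: powR_ge0.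
by apply: gt0_ltr_powR; rewrite ?nnegrE ?lpn_ge0 ?mod_ge0.
Qed.

(** If [t] is the larger number, then [s + t <= 2 * t]. The bound holds for all [p > 0], so closure
    of l_p under addition is proved at once for [p < 1] and [p >= 1]. *)
Lemma powR_add_le (s t : R) : 0 <= s -> 0 <= t ->
  (s + t) `^ p <= 2 `^ p * (s `^ p + t `^ p).
Proof.
wlog st : s t / s <= t => [H s0 t0|s0 t0].
  have /orP[] := le_total s t => h; first exact: H.
  by rewrite addrC [X in _ * X]addrC; apply: H.
apply: (@le_trans _ _ ((2 * t) `^ p)).
  by apply: ge0_ler_powR; rewrite ?nnegrE ?(ltW p0)//; lra.
by rewrite powRM// ler_pM2l ?powR_gt0// lerDr powR_ge0.
Qed.

Lemma lpZ a x : lp x -> lp (seq_scale a x) /\ lpn (seq_scale a x) = ab a * lpn x.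
Proof.
move=> lx.
have E k : ab (seq_scale a x k) `^ p = ab a `^ p * ab (x k) `^ p.
  by rewrite /seq_scale abM powRM ?mod_ge0.
have [h1 h2] := sumfinZ (powR_ge0 (ab a) p) (fun k => powR_ge0 (ab (x k)) p) lx.
split; first by rewrite /in_lp (funext E).
apply: lpn_psum_eq; first by rewrite mulr_ge0 ?mod_ge0 ?lpn_ge0.
by rewrite powRM ?mod_ge0 ?lpn_ge0// lpnX /psum (funext E) h2.
Qed.

Lemma lpD x y : lp x -> lp y -> lp (seq_add x y).
Proof.
move=> lx ly.
have x0 k := powR_ge0 (ab (x k)) p.
have y0 k := powR_ge0 (ab (y k)) p.
have [h _] := sumfinD x0 y0 lx ly.
have xy0 k := addr_ge0 (x0 k) (y0 k).
have [{}h _] := sumfinZ (powR_ge0 2 p) xy0 h.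
apply: (proj1 (sumfin_le _ _ h)) => k; first exact: powR_ge0.
apply: le_trans (powR_add_le (mod_ge0 (x k)) (mod_ge0 (y k))).
by apply: ge0_ler_powR; rewrite ?nnegrE ?addr_ge0 ?mod_ge0 ?(ltW p0)// abD.
Qed.

(** Linearity is only assumed on combinations [a x + y], and this puts differences into that
    shape. *)
Lemma seq_sub_linearE x y : Defs.seq_sub x y = seq_add (seq_scale (-1) y) x.
Proof. by apply/funext => k; rewrite /Defs.seq_sub /seq_add /seq_scale mulN1r addrC. Qed.

Lemma lpB x y : lp x -> lp y -> lp (Defs.seq_sub x y).
Proof. by move=> lx ly; rewrite seq_sub_linearE; exact: lpD (lpZ (-1) ly).1 lx. Qed.

Lemma lpn_mono x y : lp y -> (forall k, ab (x k) <= ab (y k)) -> lp x /\ lpn x <= lpn y.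
Proof.
move=> ly xy.
have [lx le] : lp x /\ psum x <= psum y.
  apply: sumfin_le => // k; first exact: powR_ge0.
  by apply: ge0_ler_powR; rewrite ?nnegrE ?mod_ge0 ?(ltW p0).
split; first exact: lx.
by rewrite (lpn_le x (lpn_ge0 y)) (lpnX y).
Qed.

Lemma lp0 : lp (fun=> 0).
Proof.
apply: (proj1 (psum_bounded (M := 0) _)) => n.
by rewrite big1// => k _; rewrite mod0 powR0 ?gt_eqF.
Qed.

Definition linear_on_lp (f : (nat -> K) -> K) : Prop :=
  forall a x y, lp x -> lp y -> f (seq_add (seq_scale a x) y) = a * f x + f y.

Lemma linear_on_lp_sub f x y : linear_on_lp f -> lp x -> lp y ->
  f (Defs.seq_sub x y) = f x - f y.
Proof. by move=> fl lx ly; rewrite seq_sub_linearE fl// mulN1r addrC. Qed.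

Lemma in_dual_bounded f B : linear_on_lp f ->
  (forall x, lp x -> ab (f x) <= B * lpn x) -> in_dual ab p f.
Proof.
move=> fl fB; split=> // x lx e e0.
(* [B] may be zero or negative, so the modulus of continuity divides by [Num.max B 1]. *)
have B0 : 0 < Num.max B 1 by rewrite lt_max ltr01 orbT.
exists (e / Num.max B 1); first by rewrite divr_gt0.
move=> y ly d; rewrite -linear_on_lp_sub//.
apply: le_lt_trans (fB _ (lpB ly lx)) _.
apply: (@le_lt_trans _ _ (Num.max B 1 * lpn (Defs.seq_sub y x))).
  by rewrite ler_wpM2r ?lpn_ge0// le_max lexx.
by rewrite mulrC -ltr_pdivlMr.
Qed.

End LpSpace.
Arguments psum {R K} ab p x.
Arguments linear_on_lp {R K} ab p f.

(** * The real and complex absolute values *)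

Section RealModulus.
Import numFieldNormedType.Exports.
Variable R : realType.

Lemma real_complete (u : nat -> R) :
  (forall e, 0 < e -> exists N, forall n, (N <= n)%N -> `|u n - u N| < e) ->
  exists l, forall e, 0 < e -> exists N, forall n, (N <= n)%N -> `|u n - l| < e.
Proof.
move=> cu.
have /cauchy_cvgP cvu : cauchy (u @ \oo)%classic.
  apply: cauchy_exP => e e0; have [N uN] := cu e e0.
  exists (u N), N => //= n /uN; rewrite distrC.
  by rewrite /ball /=.
exists (lim (u @ \oo)%classic) => e e0.
have /cvgrPdist_lt/(_ e e0) [N _ h] := cvu.
by exists N => n /h /=; rewrite distrC.
Qed.

Lemma real_modulus :
  is_modulus (fun x : R => `|x|) (idfun : {rmorphism R -> R}).
Proof.
split => //.
- exact: normrM.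
- exact: ler_normD.
- by move=> x /eqP; rewrite normr_eq0 => /eqP.
- by move=> x y; rewrite !real_normK ?num_real//; ring.
- exact: real_complete.
Qed.

End RealModulus.

Section ComplexModulus.
Variable R : realType.
Implicit Types z w : complex.complex R.

Lemma cabs_normc z : cabs z = complex.ComplexField.Normc.normc z.
Proof. by case: z. Qed.

Lemma sqr_cabs z : cabs z ^+ 2 = complex.Re z ^+ 2 + complex.Im z ^+ 2.
Proof. by rewrite /cabs sqr_sqrtr// addr_ge0 ?sqr_ge0. Qed.

Lemma cabs_ge_Re z : `|complex.Re z| <= cabs z.
Proof.
by rewrite -sqrtr_sqr ler_sqrt ?addr_ge0 ?sqr_ge0// lerDl sqr_ge0.
Qed.

Lemma cabs_ge_Im z : `|complex.Im z| <= cabs z.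
Proof.
by rewrite -sqrtr_sqr ler_sqrt ?addr_ge0 ?sqr_ge0// lerDr sqr_ge0.
Qed.

Lemma cabs_le_ReIm z : cabs z <= `|complex.Re z| + `|complex.Im z|.
Proof.
rewrite -(@ler_pXn2r _ 2) ?nnegrE ?sqrtr_ge0 ?addr_ge0//.
rewrite sqr_cabs -(real_normK (num_real (complex.Re z))).
rewrite -(real_normK (num_real (complex.Im z))) sqrrD.
rewrite -[leLHS]addr0 -addrA -[leRHS]addrA lerD2l addr0 lerDr.
by rewrite mulrn_wge0// mulr_ge0.
Qed.

Lemma complex_modulus : is_modulus (@cabs R)
  (complex.real_complex R : {rmorphism R -> complex.complex R}).
Proof.
split.
- by move=> x y; rewrite !cabs_normc complex.ComplexField.Normc.normcM.
- by move=> x y; rewrite !cabs_normc complex.le_normcD.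
- by move=> x; rewrite cabs_normc; exact: complex.ComplexField.Normc.eq0_normc.
- move=> [a b] [c d]; rewrite !sqr_cabs /=; ring.
- by move=> r; rewrite /cabs /= expr0n addr0 sqrtr_sqr.
move=> u cu.
have [|a ha] := @real_complete R (fun n => complex.Re (u n)).
  move=> e e0; have [N h] := cu e e0; exists N => n /h; apply: le_lt_trans.
  by have := cabs_ge_Re (u n - u N); case: (u n) (u N) => ? ? [].
have [|b hb] := @real_complete R (fun n => complex.Im (u n)).
  move=> e e0; have [N h] := cu e e0; exists N => n /h; apply: le_lt_trans.
  by have := cabs_ge_Im (u n - u N); case: (u n) (u N) => ? ? [].
exists (complex.Complex a b) => e e0.
have e20 : 0 < e / 2 by lra.
have [N1 h1] := ha _ e20; have [N2 h2] := hb _ e20.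
exists (maxn N1 N2) => n; rewrite geq_max => /andP[/h1 {}h1 /h2 {}h2].
apply: le_lt_trans (cabs_le_ReIm _) _.
by move: h1 h2; case: (u n) => c d /= h1 h2; lra.
Qed.

End ComplexModulus.

(** * Averages over signs *)

Section RademacherAverage.
Context {R : realType}.

(** The expectation of [F] at [s + e_1 x_1 + ... + e_n x_n] for independent uniform signs [e_i],
    computed by conditioning on the first sign. *)
Fixpoint rad_mean {V : zmodType} (l : seq V) (F : V -> R) (s : V) : R :=
  if l is x :: l' then (rad_mean l' F (s + x) + rad_mean l' F (s - x)) / 2 else F s.

(** The set of values that the random sum in [rad_mean] takes. *)
Fixpoint signed_sum {V : zmodType} (l : seq V) (s v : V) : Prop :=
  if l is x :: l' then signed_sum l' (s + x) v \/ signed_sum l' (s - x) v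
  else v = s.

Lemma rad_mean_le (V : zmodType) (l : seq V) (F G : V -> R) s :
  (forall v, signed_sum l s v -> F v <= G v) -> rad_mean l F s <= rad_mean l G s.
Proof.
elim: l s => [|x l IH] s /= h; first exact: h.
have h1 := IH (s + x) (fun v hv => h v (or_introl hv)).
have h2 := IH (s - x) (fun v hv => h v (or_intror hv)).
by rewrite ler_pM2r ?lerD ?invr_gt0.
Qed.

Lemma rad_mean_cst (V : zmodType) (l : seq V) (c : R) s : rad_mean l (fun=> c) s = c.
Proof. by elim: l s => [|x l IH] s //=; rewrite !IH; lra. Qed.

Lemma rad_meanD (V : zmodType) (l : seq V) (F G : V -> R) s :
  rad_mean l (fun v => F v + G v) s = rad_mean l F s + rad_mean l G s.
Proof. by elim: l s => [|x l IH] s //=; rewrite !IH; ring. Qed.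

Lemma rad_meanZ (V : zmodType) (l : seq V) (c : R) (F : V -> R) s :
  rad_mean l (fun v => c * F v) s = c * rad_mean l F s.
Proof. by elim: l s => [|x l IH] s //=; rewrite !IH; ring. Qed.

Lemma rad_mean_sum (V : zmodType) (I : Type) (r : seq I) (l : seq V)
    (F : I -> V -> R) s :
  rad_mean l (fun v => \sum_(i <- r) F i v) s = \sum_(i <- r) rad_mean l (F i) s.
Proof.
elim: r => [|i r IH].
  by under eq_fun do rewrite big_nil; rewrite rad_mean_cst big_nil.
by under eq_fun do rewrite big_cons; rewrite rad_meanD IH big_cons.
Qed.

(** Used with [h] the evaluation at a coordinate, to pass from sign sums of sequences to sign sums
    of scalars. *)
Lemma rad_mean_map (V W : zmodType) (h : V -> W) (l : seq V) (F : W -> R) s :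
  {morph h : x y / x + y} -> {morph h : x y / x - y} ->
  rad_mean l (fun v => F (h v)) s = rad_mean (map h l) F (h s).
Proof. by move=> hD hB; elim: l s => [|x l IH] s //=; rewrite !IH hD hB. Qed.

End RademacherAverage.

(** * Moments of sign sums and the lower Khintchine inequality *)

Section Khintchine.
Context {R : realType} {K : numFieldType} {ab : K -> R}
  {emb : {rmorphism R -> K}} (abP : is_modulus ab emb).

Definition sqsum (l : seq K) : R := \sum_(a <- l) ab a ^+ 2.

Lemma sqsum_ge0 l : 0 <= sqsum l.
Proof. by apply: sumr_ge0 => a _; exact: sqr_ge0. Qed.

Lemma rad_moment2 (l : seq K) s :
  rad_mean l (fun z => ab z ^+ 2) s = ab s ^+ 2 + sqsum l.
Proof.
elim: l s => [|a l IH] s /=; first by rewrite /sqsum big_nil addr0.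
rewrite !IH /sqsum big_cons; have := mod_parallelogram abP s a; lra.
Qed.

(** By the parallelogram law the squares of [ab (s + a)] and [ab (s - a)] are
    [ab s ^+ 2 + ab a ^+ 2] plus and minus one number [B]; the triangle inequality gives
    [|B| <= 2 * (ab s * ab a)], and the sum of fourth powers is quadratic in [B]. *)
Lemma fourth_power_average s a :
  ab (s + a) ^+ 4 + ab (s - a) ^+ 4 <=
  2 * (ab s ^+ 4 + 6 * (ab s ^+ 2 * ab a ^+ 2) + ab a ^+ 4).
Proof.
have par := mod_parallelogram abP s a.
have h1 := modD abP s a; have h2 := modB abP s a.
have p0 := mod_ge0 abP (s + a); have m0 := mod_ge0 abP (s - a).
have s0 := mod_ge0 abP s; have a0 := mod_ge0 abP a.
move: (ab (s + a)) (ab (s - a)) (ab s) (ab a) par h1 h2 p0 m0 s0 a0.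
move=> P M S A par h1 h2 P0 M0 S0 A0.
have u1 : P ^+ 2 <= (S + A) ^+ 2 by rewrite ler_pXn2r ?nnegrE ?addr_ge0.
have u2 : M ^+ 2 <= (S + A) ^+ 2 by rewrite ler_pXn2r ?nnegrE ?addr_ge0.
set B := P ^+ 2 - (S ^+ 2 + A ^+ 2).
have eP : P ^+ 2 = S ^+ 2 + A ^+ 2 + B by rewrite /B; ring.
have eM : M ^+ 2 = S ^+ 2 + A ^+ 2 - B by rewrite /B; lra.
have b1 : B <= 2 * (S * A) by move: u1; rewrite eP sqrrD mulr2n; lra.
have b2 : - (2 * (S * A)) <= B by move: u2; rewrite eM sqrrD mulr2n; lra.
have B2 : 0 <= (2 * (S * A) - B) * (2 * (S * A) + B).
  by rewrite mulr_ge0//; lra.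
have -> : P ^+ 4 = (P ^+ 2) ^+ 2 by rewrite -exprM.
have -> : M ^+ 4 = (M ^+ 2) ^+ 2 by rewrite -exprM.
rewrite eP eM -subr_ge0.
suff -> : 2 * (S ^+ 4 + 6 * (S ^+ 2 * A ^+ 2) + A ^+ 4) -
  ((S ^+ 2 + A ^+ 2 + B) ^+ 2 + (S ^+ 2 + A ^+ 2 - B) ^+ 2) =
  2 * ((2 * (S * A) - B) * (2 * (S * A) + B)) by rewrite mulr_ge0.
ring.
Qed.

(** The case [s = 0] bounds the fourth moment by 3 times the squared second moment; a general
    starting point is what the induction needs. *)
Lemma rad_moment4 (l : seq K) s :
  rad_mean l (fun z => ab z ^+ 4) s <=
  ab s ^+ 4 + 6 * (ab s ^+ 2 * sqsum l) + 3 * sqsum l ^+ 2.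
Proof.
elim: l s => [|a l IH] s /=.
  by rewrite /sqsum big_nil mulr0 mulr0 expr0n/= mulr0 !addr0.
have h1 := IH (s + a); have h2 := IH (s - a).
have h4 := fourth_power_average s a; have h3 := mod_parallelogram abP s a.
have -> : sqsum (a :: l) = ab a ^+ 2 + sqsum l by rewrite /sqsum big_cons.
have s0 := sqsum_ge0 l.
move: (rad_mean _ _ _) (rad_mean _ _ _) h1 h2 => X Y h1 h2.
have e : ab (s + a) ^+ 2 * sqsum l + ab (s - a) ^+ 2 * sqsum l =
   2 * (ab s ^+ 2 + ab a ^+ 2) * sqsum l by rewrite -mulrDl h3.
have a4 : 0 <= ab a ^+ 4 by rewrite exprn_ge0 ?(mod_ge0 abP).
have -> : (ab a ^+ 2 + sqsum l) ^+ 2 =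
  ab a ^+ 4 + 2 * (ab a ^+ 2 * sqsum l) + sqsum l ^+ 2 by ring.
lra.
Qed.

(* Paley-Zygmund in polynomial form: [u^2 - u^4/4 - 1/8] is at most [1], is
   nonpositive for [u^2 <= 1/8], and has mean at least [1/8]
   when [E u^2 = 1] and [E u^4 <= 3]. *)
Lemma powR_ge_poly (p u : R) : 0 < p -> 0 <= u ->
  (8^-1 `^ (p / 2)) * (u ^+ 2 - u ^+ 4 / 4 - 8^-1) <= u `^ p.
Proof.
move=> p0 u0; have c0 : 0 < (8^-1 : R) `^ (p / 2) by apply: powR_gt0; lra.
have e4 : u ^+ 4 = (u ^+ 2) ^+ 2 by rewrite -exprM.
have [h|h] := leP (u ^+ 2) 8^-1.
  apply: (@le_trans _ _ 0); last exact: powR_ge0.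
  rewrite pmulr_rle0// e4; have := sqr_ge0 (u ^+ 2); lra.
have -> : u `^ p = (u ^+ 2) `^ (p / 2).
  by rewrite -(powR_mulrn 2 u0) -powRrM mulrC divfK.
apply: (@le_trans _ _ ((8^-1 `^ (p / 2)) * 1)).
  rewrite ler_pM2l// e4; have := sqr_ge0 (u ^+ 2 - 2); rewrite sqrrB mulr2n; lra.
rewrite mulr1; apply: ge0_ler_powR; rewrite ?nnegrE ?sqr_ge0 ?ltW//; lra.
Qed.

(** Apply [powR_ge_poly] to [u = ab z / sg], with [sg] the l_2 norm of [l], and take means: the
    second moment of [u] is 1 and the fourth at most 3, which leaves [1 - 3/4 - 1/8 = 1/8]. *)
Lemma khintchine_lower (p : R) (l : seq K) : 0 < p ->
  (8^-1 `^ (p / 2)) / 8 * Num.sqrt (sqsum l) `^ p <=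
  rad_mean l (fun z => ab z `^ p) 0.
Proof.
move=> p0; have := sqsum_ge0 l; rewrite le_eqVlt => /predU1P[<-|s0].
  rewrite sqrtr0 powR0 ?gt_eqF// mulr0.
  by rewrite -[leLHS](rad_mean_cst l 0 0); apply: rad_mean_le => v _; exact: powR_ge0.
set sg := Num.sqrt _; have sg0 : 0 < sg by rewrite sqrtr_gt0.
have sg2 : sg ^+ 2 = sqsum l by rewrite sqr_sqrtr// ltW.
set c := 8^-1 `^ (p / 2); have c0 : 0 < c by apply: powR_gt0; lra.
(* [G] is the polynomial lower bound, expanded into monomials so that its mean follows from the two
   moments. *)
set G := fun z : K => (c * sg `^ p / sg ^+ 2) * ab z ^+ 2 +
  ((- (c * sg `^ p / (4 * sg ^+ 4))) * ab z ^+ 4 + - (c * sg `^ p / 8)).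
apply: (@le_trans _ _ (rad_mean l G 0)); last first.
  apply: rad_mean_le => z _; rewrite /G.
  have h := @powR_ge_poly p (ab z / sg) p0 (divr_ge0 (mod_ge0 abP z) (ltW sg0)).
  have -> : ab z `^ p = sg `^ p * (ab z / sg) `^ p.
    rewrite -powRM ?(ltW sg0) ?divr_ge0 ?(mod_ge0 abP)//; last exact: ltW.
    by rewrite mulrC divfK ?gt_eqF.
  apply: le_trans (ler_wpM2l (powR_ge0 _ _) h); rewrite -/c.
  rewrite le_eqVlt; apply/orP; left; apply/eqP; field; by rewrite gt_eqF.
rewrite /G !rad_meanD !rad_meanZ !rad_mean_cst rad_moment2 (mod0 abP).
have := rad_moment4 l 0; rewrite (mod0 abP) -sg2.
rewrite !expr0n/= mul0r mulr0 !add0r => h.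
have k0 : 0 < sg `^ p by rewrite powR_gt0.
apply: (@le_trans _ _ (c * sg `^ p / sg ^+ 2 * sg ^+ 2 +
  (- (c * sg `^ p / (4 * sg ^+ 4)) * (3 * (sg ^+ 2) ^+ 2) + - (c * sg `^ p / 8)))).
  by rewrite le_eqVlt; apply/orP; left; apply/eqP; field; rewrite gt_eqF.
rewrite lerD2l lerD2r !mulNr lerN2 ler_pM2l//.
by rewrite divr_gt0 ?mulr_gt0 ?exprn_gt0.
Qed.

End Khintchine.

(** * Uniform boundedness in the dual of l_p, p >= 1 *)

Section ConvergenceInModulus.
Context {R : realType} {K : numFieldType} {ab : K -> R}
  {emb : {rmorphism R -> K}} (abP : is_modulus ab emb).

Definition converges (u : nat -> K) (l : K) : Prop :=
  forall e, 0 < e -> exists N, forall n, (N <= n)%N -> ab (u n - l) < e.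

Lemma converges_dist_le (u : nat -> K) l c (B : R) N : converges u l ->
  (forall n, (N <= n)%N -> ab (u n - c) <= B) -> ab (l - c) <= B.
Proof.
move=> ul uB; apply/ler_addgt0Pr => e e0.
have [M h] := ul e e0.
have h1 := h (maxn M N) (leq_maxl _ _); have h2 := uB (maxn M N) (leq_maxr _ _).
have := modB abP (u (maxn M N) - c) (u (maxn M N) - l).
have -> : u (maxn M N) - c - (u (maxn M N) - l) = l - c by ring.
lra.
Qed.

Lemma converges_unique (u : nat -> K) l c : converges u l -> converges u c -> l = c.
Proof.
move=> ul uc; apply/eqP; rewrite -subr_eq0; apply/eqP/(mod_eq0 abP).
apply/le_anti; rewrite (mod_ge0 abP) andbT; apply/ler_addgt0Pr => e e0.
have [N h] := uc e e0; rewrite add0r.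
by apply: (converges_dist_le (N := N) ul) => n /h/ltW.
Qed.

Lemma converges_linear a (u v : nat -> K) l c : converges u l -> converges v c ->
  converges (fun n => a * u n + v n) (a * l + c).
Proof.
move=> ul vc e e0.
have a0 := mod_ge0 abP a.
have d0 : 0 < e / (2 * (ab a + 1)) by rewrite divr_gt0// mulr_gt0//; lra.
have e20 : 0 < e / 2 by lra.
have [N hN] := ul _ d0; have [M hM] := vc _ e20.
exists (maxn N M) => n; rewrite geq_max => /andP[/hN {}hN /hM {}hM].
have -> : a * u n + v n - (a * l + c) = a * (u n - l) + (v n - c) by ring.
apply: le_lt_trans (modD abP _ _) _; rewrite (modM abP).
rewrite [ltRHS](splitr e) ler_ltD//.
apply: (@le_trans _ _ ((ab a + 1) * (e / (2 * (ab a + 1))))).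
  by apply: ler_pM; rewrite ?(mod_ge0 abP) ?(ltW hN)//; lra.
rewrite le_eqVlt; apply/orP; left; apply/eqP; field.
by rewrite gt_eqF//; lra.
Qed.

End ConvergenceInModulus.

Section DualOfLp.
Context {R : realType} {K : numFieldType} {ab : K -> R}
  {emb : {rmorphism R -> K}} (abP : is_modulus ab emb) {p : R} (p1 : 1 <= p).

Local Notation lpn := (lpnorm ab p).
Local Notation lp := (in_lp ab p).
Local Notation abs_ge0 := (mod_ge0 abP).

Let p0 : 0 < p. Proof. by apply: lt_le_trans p1. Qed.

(** A coarse Young inequality: replace the smaller of [a] and [b] by the larger. No conjugate
    exponent occurs, so [p = 1] is included. *)
Lemma young_crude (a b : R) : 0 <= a -> 0 <= b -> a `^ (p - 1) * b <= a `^ p + b `^ p.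
Proof.
move=> a0 b0; have [ab_le|ba] := leP a b.
  apply: (@le_trans _ _ (b `^ (p - 1) * b)).
    rewrite ler_wpM2r//; apply: ge0_ler_powR; rewrite ?nnegrE ?subr_ge0//.
  by rewrite mulrC mulr_powRB1// lerDr powR_ge0.
apply: (@le_trans _ _ (a `^ (p - 1) * a)).
  by rewrite ler_wpM2l ?powR_ge0// ltW.
by rewrite mulrC mulr_powRB1// lerDl powR_ge0.
Qed.

Lemma normalized_partial x n : 0 < lpn x ->
  \sum_(0 <= k < n) (ab (x k) / lpn x) `^ p =
  (\sum_(0 <= k < n) ab (x k) `^ p) / psum ab p x.
Proof.
move=> x0; rewrite mulr_suml; apply: eq_bigr => k _.
by rewrite powRM ?abs_ge0 ?invr_ge0 ?(ltW x0)// -[in RHS](lpnX p0) -powR_inv1 ?(ltW x0)//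
  -powRrM mulN1r powRN.
Qed.

Lemma normalized_partial_le1 x n : lp x -> 0 < lpn x ->
  \sum_(0 <= k < n) (ab (x k) / lpn x) `^ p <= 1.
Proof.
move=> lx x0; rewrite (normalized_partial n x0).
have s0 : 0 < psum ab p x by rewrite -(lpnX p0) powR_gt0.
by rewrite ler_pdivrMr// mul1r; exact: partial_le_psum.
Qed.

Lemma norming_functional v : lp v -> exists f : (nat -> K) -> K,
  [/\ linear_on_lp ab p f, forall x, lp x -> ab (f x) <= 2 * lpn x
    & lpn v <= 2 * ab (f v)].
Proof.
move=> lv; have := lpn_ge0 (ab := ab) (p := p) v.
rewrite le_eqVlt => /predU1P[v0|v0].
  exists (fun=> 0); split.
  - by move=> a x y _ _; rewrite mulr0 addr0.
  - by move=> x _; rewrite (mod0 abP) mulr_ge0 ?lpn_ge0.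
  - by rewrite -v0 (mod0 abP) mulr0.
have [n hn] := tsum_ge_half (fun k => powR_ge0 (ab (v k)) p) lv.
pose w k := (ab (v k) / lpn v) `^ (p - 1).
(* When [v k = 0] the quotient is 0 by convention, so [y k = 0]. *)
pose y k := emb (ab (v k)) / v k * emb (w k).
have w0 k : 0 <= w k by exact: powR_ge0.
have yle k : ab (y k) <= w k.
  rewrite /y (modM abP) (mod_emb abP) (ger0_norm (w0 k)) ler_piMl//.
  have [->|vk] := eqVneq (v k) 0; first by rewrite (mod0 abP) rmorph0 mul0r (mod0 abP).
  have h : ab (emb (ab (v k)) / v k) * ab (v k) = ab (v k).
    by rewrite -(modM abP) divfK// (mod_emb abP) ger0_norm ?abs_ge0.
  by rewrite -(ler_pM2r (mod_gt0 abP vk)) h mul1r.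
have yv k : y k * v k = emb (w k * ab (v k)).
  rewrite /y; have [->|vk] := eqVneq (v k) 0.
    by rewrite !(mod0 abP) !mulr0 rmorph0.
  by rewrite mulrAC divfK// rmorphM mulrC.
exists (fun x => \sum_(0 <= k < n) y k * x k); split.
- move=> a x z _ _; rewrite mulr_sumr -big_split/=; apply: eq_bigr => k _.
  by rewrite /seq_add /seq_scale; ring.
- move=> x lx; apply: le_trans (mod_sum abP _ _ _) _.
  have := lpn_ge0 (ab := ab) (p := p) x; rewrite le_eqVlt => /predU1P[x0|x0].
    rewrite -x0 mulr0 big1// => k _; rewrite (modM abP).
    suff -> : ab (x k) = 0 by rewrite mulr0.
    by apply/le_anti; rewrite abs_ge0 andbT x0 (coord_le_lpn abP p0).
  apply: (@le_trans _ _ (\sum_(0 <= k < n)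
     (lpn x * ((ab (v k) / lpn v) `^ p + (ab (x k) / lpn x) `^ p)))).
    apply: ler_sum => k _; rewrite (modM abP).
    apply: (@le_trans _ _ (w k * ab (x k))); first by rewrite ler_wpM2r ?abs_ge0.
    have -> : w k * ab (x k) = lpn x * (w k * (ab (x k) / lpn x)).
      by field; rewrite gt_eqF.
    rewrite ler_pM2l//; apply: young_crude; rewrite divr_ge0 ?abs_ge0 ?lpn_ge0//.
  rewrite -mulr_sumr big_split/= mulrC (ler_pM2r x0).
  exact: lerD (normalized_partial_le1 n lv v0) (normalized_partial_le1 n lx x0).
- under eq_bigr do rewrite yv; rewrite -rmorph_sum (mod_emb abP) ger0_norm; last first.
    by apply: sumr_ge0 => k _; rewrite mulr_ge0 ?abs_ge0.
  under eq_bigr => k _.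
    have -> : w k * ab (v k) = lpn v * (ab (v k) / lpn v) `^ p.
      rewrite /w -(mulr_powRB1 _ p0); first by field; rewrite gt_eqF.
      by rewrite divr_ge0 ?abs_ge0 ?lpn_ge0.
    over.
  rewrite -mulr_sumr (normalized_partial n v0) mulrCA ler_peMr ?(ltW v0)//.
  have s0 : 0 < psum ab p v by rewrite -(lpnX p0) powR_gt0.
  by rewrite mulrA ler_pdivlMr// mul1r.
Qed.

(** * Sokal's argument for uniform boundedness *)

Section Sokal.
Variables (f : nat -> (nat -> K) -> K) (v : nat -> nat -> K).
Hypotheses (f_lin : forall i, linear_on_lp ab p (f i))
  (f_le : forall i x, lp x -> ab (f i x) <= 2 * lpn x)
  (v_lp : forall i, lp (v i))
  (f_norming : forall i, lpn (v i) <= 2 * ab (f i (v i))).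

(* Sokal's choice of signs: one of the two values [|g + h|], [|g - h|] is at
   least [|h|]. *)
Fixpoint sokal (n : nat) : (nat -> K) -> K :=
  if n is n'.+1 then
    let h x := emb (17^-1 ^+ n') * f n' x in
    if ab (h (v n')) <= ab (sokal n' (v n') + h (v n'))
    then fun x => sokal n' x + h x else fun x => sokal n' x - h x
  else fun=> 0.

Lemma sokal_linear n : linear_on_lp ab p (sokal n).
Proof.
elim: n => [|n IH] a x y lx ly /=; first by rewrite mulr0 addr0.
by case: ifP => _; rewrite IH// f_lin//; ring.
Qed.

Let eta_gt0 n : 0 < (17^-1 : R) ^+ n. Proof. by rewrite exprn_gt0. Qed.

Lemma sokal_step n x : lp x ->
  ab (sokal n.+1 x - sokal n x) <= 2 * 17^-1 ^+ n * lpn x.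
Proof.
move=> lx; have h : ab (emb (17^-1 ^+ n) * f n x) <= 2 * 17^-1 ^+ n * lpn x.
  rewrite (modM abP) (mod_emb abP) ger0_norm ?(ltW (eta_gt0 n))//.
  by rewrite mulrC -mulrA mulrCA [leRHS]mulrC ler_pM2r// ?f_le.
by rewrite /=; case: ifP => _; rewrite addrAC subrr add0r// (modN abP).
Qed.

Lemma sokal_large n : lpn (v n) * 17^-1 ^+ n <= 2 * ab (sokal n.+1 (v n)).
Proof.
have : ab (emb (17^-1 ^+ n) * f n (v n)) <= ab (sokal n.+1 (v n)).
  rewrite /=; case: ifP => //; move/negbT; rewrite -ltNge.
  set g := sokal n (v n); set h := emb _ * _ => gh.
  have := modB abP (g + h) (g - h).
  (* Hence [2 * ab h <= ab (g + h) + ab (g - h)]: as [ab (g + h) < ab h] in this branch, the other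
     choice is at least [ab h]. *)
  have -> : g + h - (g - h) = 2 * h by ring.
  rewrite (modM abP) -(rmorph_nat emb) (mod_emb abP) normr_nat; lra.
rewrite (modM abP) (mod_emb abP) ger0_norm ?(ltW (eta_gt0 n))// => h.
have := ler_wpM2r (ltW (eta_gt0 n)) (f_norming n); lra.
Qed.

(** Geometric telescoping of [sokal_step]: [17 / 8 = 2 / (1 - 1 / 17)]. Keeping the subtracted power
    makes the induction step an identity. *)
Lemma sokal_dist n d x : lp x ->
  ab (sokal (n + d) x - sokal n x) <= 17 / 8 * (17^-1 ^+ n - 17^-1 ^+ (n + d)) * lpn x.
Proof.
move=> lx; elim: d => [|d IH].
  by rewrite addn0 !subrr (mod0 abP) mulr0 mul0r.
have := sokal_step (n + d) lx; have := modD abP (sokal (n + d).+1 x - sokal (n + d) x)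
  (sokal (n + d) x - sokal n x).
rewrite addrA subrK addnS.
have -> : 17 / 8 * (17^-1 ^+ n - 17^-1 ^+ (n + d).+1) * lpn x =
  17 / 8 * (17^-1 ^+ n - 17^-1 ^+ (n + d)) * lpn x + 2 * 17^-1 ^+ (n + d) * lpn x.
  by rewrite exprS; field.
lra.
Qed.

Lemma sokal_dist_le n m x : lp x -> (n <= m)%N ->
  ab (sokal m x - sokal n x) <= 17 / 8 * 17^-1 ^+ n * lpn x.
Proof.
move=> lx /subnKC <-; apply: le_trans (sokal_dist _ _ lx) _.
rewrite ler_wpM2r ?lpn_ge0// ler_pM2l; last lra.
by have := eta_gt0 (n + (m - n)); lra.
Qed.

(** At [v n] stage [n.+1] has modulus at least [17^-1 ^+ n / 2] times [lpn (v n)]. All later stages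
    change it by at most [17 / 8 * 17^-1 ^+ n.+1 = 17^-1 ^+ n / 8] times that norm, and
    [1/2 - 1/8 = 3/8]. *)
Lemma sokal_limit : exists2 F : (nat -> K) -> K, in_dual ab p F &
  forall n, lpn (v n) * 17^-1 ^+ n * (3 / 8) <= ab (F (v n)).
Proof.
have cau x : lp x -> exists l, converges (ab := ab) (sokal ^~ x) l.
  move=> lx; apply: (mod_complete abP) => e e0.
  have c0 : 0 <= 17 / 8 * lpn x by rewrite mulr_ge0 ?lpn_ge0//; lra.
  have [N hN] : exists N, 17 / 8 * 17^-1 ^+ N * lpn x < e.
    exists (Num.bound (17 / 8 * lpn x / e)).
    set B := Num.bound _.
    have hB : 17 / 8 * lpn x / e < B%:R.
      by apply: archi_boundP; rewrite divr_ge0// ltW.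
    have hB' : (B%:R : R) <= 17 ^+ B.
      by rewrite -natrX ler_nat ltnW// ltn_expl.
    rewrite mulrAC exprVn ltr_pdivrMr ?exprn_gt0// [ltRHS]mulrC -ltr_pdivrMr//.
    exact: lt_le_trans hB'.
  by exists N => n Nn; apply: le_lt_trans hN; exact: sokal_dist_le.
(* [choice] needs a value for every sequence; outside l_p it is set to 0. *)
have cau' x : exists l, lp x -> converges (ab := ab) (sokal ^~ x) l.
  by have [/cau[l]|] := pselect (lp x); [exists l|exists 0].
have [F FP] := choice cau'.
have F_lin : linear_on_lp ab p F.
  move=> a x y lx ly; have l_axy := lpD abP p0 (lpZ abP p0 a lx).1 ly.
  apply: (converges_unique abP (FP _ l_axy)).
  have := converges_linear abP a (FP x lx) (FP y ly).
  by congr (converges _ _); apply/funext => n; rewrite sokal_linear.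
exists F.
  apply: (in_dual_bounded abP p0 (B := 17 / 8)) => // x lx.
  rewrite -[F x]subr0; apply: (converges_dist_le abP (N := 0) (FP x lx)) => n _.
  by have := sokal_dist_le lx (leq0n n); rewrite expr0 mulr1.
move=> n; have h : ab (F (v n) - sokal n.+1 (v n)) <= 17 / 8 * 17^-1 ^+ n.+1 * lpn (v n).
  apply: (converges_dist_le abP (N := n.+1) (FP _ (v_lp n))) => m nm.
  exact: sokal_dist_le.
have h1 := sokal_large n.
have h2 := mod_le_sub abP (sokal n.+1 (v n)) (F (v n)).
rewrite (modBC abP) in h2; move: h; rewrite exprS => h.
have e : 17 / 8 * (17^-1 * 17^-1 ^+ n) * lpn (v n) =
  lpn (v n) * 17^-1 ^+ n / 8 by field.
lra.
Qed.

End Sokal.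

(** In an unbounded [A], pick [v n] of norm above [17 ^+ n * (n%:R * 3)]. The limit functional then
    has modulus above [9 / 8 * n] at [v n], beyond any bound [M] once [n > M]. *)
Lemma weakly_bounded_bounded (A : (nat -> K) -> Prop) :
  (forall v, A v -> lp v) ->
  (forall f, in_dual ab p f -> exists M, forall v, A v -> ab (f v) <= M) ->
  exists M, forall v, A v -> lpn v <= M.
Proof.
move=> A_lp A_weak; apply: contrapT => /forallNP unb.
have big_v n : exists v, A v /\ 17 ^+ n * (n%:R * 3) < lpn v.
  have /existsNP[v /not_implyP[Av /negP]] := unb (17 ^+ n * (n%:R * 3)).
  by rewrite -ltNge => lt; exists v.
have [v vP] := choice big_v.
have v_lp n : lp (v n) by apply: A_lp; case: (vP n).
have [f fP] := choice (fun n => norming_functional (v_lp n)).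
have [F F_dual F_large] : exists2 F : (nat -> K) -> K, in_dual ab p F &
    forall n, lpn (v n) * 17^-1 ^+ n * (3 / 8) <= ab (F (v n)).
  by apply: (@sokal_limit f v) => // i; case: (fP i).
have [M hM] := A_weak F F_dual.
have M0 : 0 <= M.
  by apply: le_trans (abs_ge0 _) (hM (v 0) _); case: (vP 0).
have := archi_boundP M0; set n := Num.bound M => Mn.
have [Av lt] := vP n.
have h : n%:R * 3 < lpn (v n) * 17^-1 ^+ n.
  by rewrite exprVn ltr_pdivlMr ?exprn_gt0// mulrC.
have := hM _ Av; have := F_large n; have := ler0n R n; lra.
Qed.

End DualOfLp.

(** * Operators on l_p, p >= 1 *)

Lemma weighted_cauchy_schwarz (R : realFieldType) (I : Type) (r : seq I)
    (w u : I -> R) : (forall i, 0 <= w i) ->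
  (\sum_(i <- r) w i * u i) ^+ 2 <=
  (\sum_(i <- r) w i) * \sum_(i <- r) w i * u i ^+ 2.
Proof.
move=> w0.
(* The induction also carries the nonnegative quadratic [t |-> sum_i w_i (t - u_i)^2] in expanded
   form; its value at the new [u i] is what the inductive step requires. *)
suff [] : [/\ 0 <= \sum_(i <- r) w i,
    forall t, 0 <= (\sum_(i <- r) w i) * t ^+ 2
      - 2 * (\sum_(i <- r) w i * u i) * t + \sum_(i <- r) w i * u i ^+ 2
  & (\sum_(i <- r) w i * u i) ^+ 2 <=
    (\sum_(i <- r) w i) * \sum_(i <- r) w i * u i ^+ 2] by [].
elim: r => [|i r [S0 quad IH]].
  rewrite !big_nil; split; rewrite ?expr0n ?mul0r// => t.
  by rewrite mul0r mulr0 mul0r subr0 addr0.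
rewrite !big_cons; move: (\sum_(j <- r) w j) (\sum_(j <- r) w j * u j)
  (\sum_(j <- r) w j * u j ^+ 2) S0 quad IH => S T Q S0 quad IH.
have wi := w0 i; split.
- by rewrite addr_ge0.
- move=> t; have := quad t; have : 0 <= w i * (t - u i) ^+ 2 by rewrite mulr_ge0 ?sqr_ge0.
  by rewrite sqrrB mulr2n; lra.
- have h : 0 <= w i * (S * u i ^+ 2 - 2 * T * u i + Q) by rewrite mulr_ge0.
  have -> : (w i * u i + T) ^+ 2 = w i ^+ 2 * u i ^+ 2 + 2 * w i * u i * T + T ^+ 2 by ring.
  have -> : (w i + S) * (w i * u i ^+ 2 + Q) =
    w i ^+ 2 * u i ^+ 2 + w i * Q + w i * (S * u i ^+ 2) + S * Q by ring.
  lra.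
Qed.

Section SignedSums.
Context {R : realType} {K : numFieldType} {ab : K -> R}
  {emb : {rmorphism R -> K}} (abP : is_modulus ab emb) {p : R} (p0 : 0 < p).

Lemma signed_sum_lp (l : seq (nat -> K)) (s v : nat -> K) :
  (forall x, List.In x l -> in_lp ab p x) -> in_lp ab p s ->
  signed_sum l s v -> in_lp ab p v.
Proof.
elim: l s => [|x l IH] s hl hs /=; first by move=> ->.
have lx : in_lp ab p x by apply: hl; left.
have hl' y : List.In y l -> in_lp ab p y by move=> yl; apply: hl; right.
by case; [exact: IH hl' (lpD abP p0 hs lx)|exact: IH hl' (lpB abP p0 hs lx)].
Qed.

(** The bound does not depend on the signs, so weak summability makes all signed partial sums weakly
    bounded. *)
Lemma signed_sum_functional_le (f : (nat -> K) -> K) (l : seq (nat -> K))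
    (s v : nat -> K) : linear_on_lp ab p f ->
  (forall x, List.In x l -> in_lp ab p x) -> in_lp ab p s ->
  signed_sum l s v -> ab (f v) <= ab (f s) + \sum_(x <- l) ab (f x).
Proof.
move=> f_lin; elim: l s => [|x l IH] s hl hs /=.
  by move=> ->; rewrite big_nil addr0.
have lx : in_lp ab p x by apply: hl; left.
have hl' y : List.In y l -> in_lp ab p y by move=> yl; apply: hl; right.
rewrite big_cons addrA; case => h.
- have h1 := IH (s + x) hl' (lpD abP p0 hs lx) h.
  apply: le_trans h1 _; rewrite lerD2r.
  have -> : s + x = seq_add (seq_scale 1 s) x.
    by apply/funext => k; rewrite /seq_add /seq_scale mul1r.
  by rewrite f_lin// mul1r (modD abP).
- have h1 := IH (s - x) hl' (lpB abP p0 hs lx) h.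
  apply: le_trans h1 _; rewrite lerD2r.
  have -> : s - x = Defs.seq_sub s x by [].
  by rewrite (linear_on_lp_sub f_lin hs lx) (modB abP).
Qed.

End SignedSums.

(** * Weakly summable sequences and their square functions *)

Section WeaklySummable.
Context {R : realType} {K : numFieldType} {ab : K -> R}
  {emb : {rmorphism R -> K}} (abP : is_modulus ab emb) {p : R} (p1 : 1 <= p).

Local Notation lpn := (lpnorm ab p).
Local Notation lp := (in_lp ab p).
Local Notation abs_ge0 := (mod_ge0 abP).

Let p0 : 0 < p. Proof. by apply: lt_le_trans p1. Qed.

Variable xs : nat -> nat -> K.
Hypotheses (xs_lp : forall k, lp (xs k))
  (xs_weak : forall f, in_dual ab p f -> sumfin (fun k => ab (f (xs k)))).

Definition sqfun (n j : nat) : R := Num.sqrt (\sum_(0 <= k < n) ab (xs k j) ^+ 2).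

Lemma in_initial_segment_lp n x : List.In x [seq xs k | k <- index_iota 0 n] -> lp x.
Proof. by elim: (index_iota 0 n) => [|k s IH] //= [<-|/IH]. Qed.

Lemma sqfun_summable : exists2 W, 0 <= W &
  forall n J, \sum_(0 <= j < J) sqfun n j `^ p <= W.
Proof.
pose A (v : nat -> K) := exists n, signed_sum [seq xs k | k <- index_iota 0 n] (fun=> 0) v.
have [M hM] : exists M, forall v, A v -> lpn v <= M.
  apply: (weakly_bounded_bounded abP p1).
    move=> v [n]; apply: (signed_sum_lp abP p0); first exact: in_initial_segment_lp.
    exact: (lp0 abP p0).
  move=> f fd; exists (ab (f (fun=> 0)) + tsum (fun k => ab (f (xs k)))) => v [n] h.
  have l0 := lp0 abP p0.
  apply: le_trans (signed_sum_functional_le abP p0 fd.1 (@in_initial_segment_lp n) l0 h) _.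
  rewrite lerD2l big_map; exact: partial_le_tsum n (fun k => abs_ge0 (f (xs k))) (xs_weak fd).
have M0 : 0 <= M by apply: le_trans (lpn_ge0 _) (hM (fun=> 0) _); exists 0%N.
set c : R := 8^-1 `^ (p / 2) / 8.
have c0 : 0 < c by rewrite divr_gt0// powR_gt0// invr_gt0.
exists (M `^ p / c); first by rewrite divr_ge0 ?powR_ge0 ?ltW.
move=> n J; rewrite ler_pdivlMr// mulrC mulr_sumr.
set l := [seq xs k | k <- index_iota 0 n].
apply: (@le_trans _ _ (rad_mean l (fun v => \sum_(0 <= j < J) ab (v j) `^ p) (fun=> 0))).
  rewrite rad_mean_sum; apply: ler_sum => j _.
  rewrite (@rad_mean_map _ _ K (fun v : nat -> K => v j) l (fun z => ab z `^ p))//.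
  have -> : sqfun n j = Num.sqrt (sqsum (ab := ab) [seq v j | v <- l]).
    by rewrite /sqfun /sqsum /l !big_map.
  exact: (khintchine_lower abP).
rewrite -[leRHS](rad_mean_cst l _ (fun=> 0)); apply: rad_mean_le => v vl.
have Av : A v by exists n.
have lv : lp v.
  by apply: (signed_sum_lp abP p0) vl; [exact: in_initial_segment_lp|exact: (lp0 abP p0)].
apply: le_trans (partial_le_psum J lv) _.
by rewrite -(lpn_le p0)// hM.
Qed.

(** Put [u k j = ab (xs k j) / sg j], a number in [[0, 1]]. As [p >= 1], the [p]-th power of
    [ab (xs k j)] is at most [sg j]^ p * u k j[. Cauchy-Schwarz with weights]sg j [^ p] bounds each
    square, and summing over [k] uses that the [u k j ^+ 2] add up to at most 1. *)
Lemma partial_psum_sqr_summable (W : R) n J : 0 <= W ->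
  \sum_(0 <= j < J) sqfun n j `^ p <= W ->
  \sum_(0 <= k < n) (\sum_(0 <= j < J) ab (xs k j) `^ p) ^+ 2 <= W ^+ 2.
Proof.
move=> W0 hW; set sg := sqfun n.
have sg0 j : 0 <= sg j by exact: sqrtr_ge0.
have sg2 j : sg j ^+ 2 = \sum_(0 <= k < n) ab (xs k j) ^+ 2.
  by rewrite sqr_sqrtr// sumr_ge0// => k _; exact: sqr_ge0.
have le_sg j k : (k < n)%N -> ab (xs k j) <= sg j.
  move=> kn; rewrite -(@ler_pXn2r _ 2) ?nnegrE ?abs_ge0// sg2.
  rewrite (bigD1_seq k) ?mem_index_iota ?iota_uniq//= lerDl.
  by rewrite sumr_ge0// => i _; exact: sqr_ge0.
(* If [sg j = 0] all quotients are 0, which is why [u2] below is only an inequality. *)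
pose u k j := ab (xs k j) / sg j.
have u0 k j : 0 <= u k j by rewrite divr_ge0 ?abs_ge0.
have pow_le j k : (k < n)%N -> ab (xs k j) `^ p <= sg j `^ p * u k j.
  move=> kn; have := sg0 j; rewrite le_eqVlt => /predU1P[s0|s0].
    have -> : ab (xs k j) = 0.
      by apply/le_anti; rewrite abs_ge0 andbT s0 le_sg.
    by rewrite powR0 ?gt_eqF// mulr_ge0 ?powR_ge0.
  have u1 : u k j <= 1 by rewrite ler_pdivrMr// mul1r le_sg.
  have -> : ab (xs k j) `^ p = sg j `^ p * u k j `^ p.
    by rewrite -powRM// mulrC divfK// gt_eqF.
  rewrite ler_pM2l ?powR_gt0//.
  rewrite -(mulr_powRB1 (u0 k j) p0) ler_piMr//.
  have pow1 : (1 : R) `^ (p - 1) = 1 by rewrite powR1.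
  rewrite -[leRHS]pow1.
  by apply: ge0_ler_powR; rewrite ?nnegrE ?subr_ge0.
have u2 j : \sum_(0 <= k < n) u k j ^+ 2 <= 1.
  under eq_bigr do rewrite expr_div_n.
  rewrite -mulr_suml -sg2; have := sg0 j; rewrite le_eqVlt => /predU1P[<-|s0].
    by rewrite expr0n/= mul0r.
  by rewrite divff// expf_neq0// gt_eqF.
apply: (@le_trans _ _ (\sum_(0 <= k < n) W * \sum_(0 <= j < J) sg j `^ p * u k j ^+ 2)).
  apply: ler_sum_nat => k /andP[_ kn].
  apply: (@le_trans _ _ ((\sum_(0 <= j < J) sg j `^ p * u k j) ^+ 2)).
    rewrite ler_pXn2r ?nnegrE ?sumr_ge0//; last first.
    - by move=> j _; rewrite mulr_ge0 ?powR_ge0.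
    - by move=> j _; exact: powR_ge0.
    by apply: ler_sum => j _; exact: pow_le.
  apply: le_trans (weighted_cauchy_schwarz _ _ _) _; first by move=> j; exact: powR_ge0.
  rewrite ler_wpM2r// sumr_ge0// => j _; by rewrite mulr_ge0 ?powR_ge0 ?sqr_ge0.
rewrite -mulr_sumr expr2 ler_wpM2l//.
rewrite exchange_big/=; apply: le_trans hW; apply: ler_sum => j _.
by rewrite -mulr_sumr ler_piMr ?powR_ge0.
Qed.

Lemma weakly_summable_power_summable : sumfin (fun k => lpn (xs k) `^ (2 * p)).
Proof.
have [W W0 hW] := sqfun_summable.
have E k : lpn (xs k) `^ (2 * p) = psum ab p (xs k) ^+ 2.
  by rewrite mulrC powRrM (lpnX p0) powR_mulrn ?psum_ge0.
apply: (proj1 (@tsum_bounded _ _ (4 * W ^+ 2) _ _)) => [k|n]; first exact: powR_ge0.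
under eq_bigr do rewrite E.
have [J hJ] := choice (fun k => tsum_ge_half (fun j => powR_ge0 (ab (xs k j)) p) (xs_lp k)).
(* One cutoff that retains half of [psum] for every [k < n]; squaring the factor 2 gives the 4. *)
pose m := \max_(k < n) J k.
apply: le_trans (ler_wpM2l _ (partial_psum_sqr_summable W0 (hW n m))) => //.
rewrite mulr_sumr; apply: ler_sum_nat => k /andP[_ kn].
have -> : (4 : R) = 2 ^+ 2 by ring.
rewrite -exprMn ler_pXn2r ?nnegrE ?psum_ge0//; last first.
  by rewrite mulr_ge0// sumr_ge0// => j _; exact: powR_ge0.
apply: le_trans (hJ k) _; rewrite ler_pM2l//.
have Jm : (J k <= m)%N by rewrite /m (leq_bigmax (Ordinal kn)).
rewrite [leRHS](@big_cat_nat _ _ _ (J k))//= lerDl sumr_ge0// => j _.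
exact: powR_ge0.
Qed.

End WeaklySummable.

(** It makes [T] preserve weak summability, so that summing properties of [T] reduce to a statement
    on the sequence of images. *)
Lemma in_dual_comp (R : realType) (K : numFieldType) (ab : K -> R)
    (emb : {rmorphism R -> K}) (abP : is_modulus ab emb) (p : R) (p0 : 0 < p)
    (T : (nat -> K) -> (nat -> K)) f :
  bounded_op ab p T -> in_dual ab p f -> in_dual ab p (f \o T).
Proof.
move=> [T_lp [T_lin [C TC]]] [f_lin f_cont]; split.
  by move=> a x y lx ly /=; rewrite (T_lin a x y lx ly) (f_lin a _ _ (T_lp x lx) (T_lp y ly)).
move=> x lx e e0; have [d d0 hd] := f_cont (T x) (T_lp x lx) e e0.
have C0 : 0 < Num.max C 1 by rewrite lt_max ltr01 orbT.
exists (d / Num.max C 1); first by rewrite divr_gt0.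
move=> y ly lt; apply: hd; first exact: T_lp.
have -> : Defs.seq_sub (T y) (T x) = T (Defs.seq_sub y x).
  by rewrite (seq_sub_linearE (T y) (T x)) (seq_sub_linearE y x) (T_lin _ _ _ lx ly).
apply: le_lt_trans (TC _ (lpB abP p0 ly lx)) _.
apply: (@le_lt_trans _ _ (Num.max C 1 * lpnorm ab p (Defs.seq_sub y x))).
  by rewrite ler_wpM2r ?lpn_ge0// le_max lexx.
by rewrite mulrC -ltr_pdivlMr.
Qed.

Lemma every_op_summing_ge1 (R : realType) (K : numFieldType) (ab : K -> R)
    (emb : {rmorphism R -> K}) (p : R) :
  is_modulus ab emb -> 1 <= p -> every_op_summing ab p.
Proof.
move=> abP p1 T bT; have p0 : 0 < p by exact: lt_le_trans p1.
exists (2 * p), 1; split=> //; first lra.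
move=> xs xs_lp xs_weak; apply: (weakly_summable_power_summable abP p1) => [k|f fd].
  exact: bT.1.
have := xs_weak _ (in_dual_comp abP p0 bT fd).
by congr sumfin; apply/funext => k; rewrite powRr1 ?(mod_ge0 abP).
Qed.

(** * Lineability, p < 1 *)

(** Equal floors put both multiples in one half-open unit interval, impossible once
    [n%:R * |s - t| > 1]. *)
Lemma floor_multiples_differ (R : realType) (s t : R) : s != t ->
  exists n0, forall n, (n0 <= n)%N -> Num.floor (n%:R * s) != Num.floor (n%:R * t).
Proof.
move=> st; have d0 : 0 < `|s - t| by rewrite normr_gt0 subr_eq0.
exists (Num.bound (`|s - t|^-1)) => n hn; apply/eqP => E.
have h : `|s - t|^-1 < n%:R.
  by apply: lt_le_trans (archi_boundP _) _; rewrite ?invr_ge0 ?ler_nat.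
have h1 : 1 < `|n%:R * s - n%:R * t|.
  by rewrite -mulrBr normrM normr_nat -ltr_pdivrMr// mul1r.
have := floor_itv (n%:R * s); have := floor_itv (n%:R * t).
rewrite E intrD; move: h1; rewrite ltr_normr => /orP[] h1 /andP[a1 a2] /andP[b1 b2]; lra.
Qed.

(** * Vectors supported on a single block *)

Section BlockVectors.
Context {R : realType} {K : numFieldType} {ab : K -> R}
  {emb : {rmorphism R -> K}} (abP : is_modulus ab emb) {p : R} (p0 : 0 < p).

Local Notation lpn := (lpnorm ab p).
Local Notation lp := (in_lp ab p).
Local Notation abs_ge0 := (mod_ge0 abP).

Definition unit_seq (j : nat) : nat -> K := fun k => (k == j)%:R.

Lemma unit_seq_lpn j : lp (unit_seq j) /\ lpn (unit_seq j) = 1.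
Proof.
have [||h1 h2] := @tsum_single R (fun k => ab (unit_seq j k) `^ p) j.
- by move=> k; exact: powR_ge0.
- by move=> k /negbTE kj; rewrite /unit_seq kj (mod0 abP) powR0 ?gt_eqF.
split; first exact: h1.
by apply: (lpn_psum_eq p0) => //; rewrite /psum h2 /unit_seq eqxx (mod1 abP) powR1.
Qed.

Lemma linear_on_lp0 f : linear_on_lp ab p f -> f (fun=> 0) = 0.
Proof.
move=> f_lin; have l0 := lp0 abP p0.
have := f_lin 1 _ _ l0 l0.
have -> : seq_add (seq_scale 1 (fun=> 0)) (fun=> 0) = (fun=> 0 : K).
  by apply/funext => k; rewrite /seq_add /seq_scale mulr0 addr0.
by rewrite mul1r => /esym/eqP; rewrite -subr_eq0 addrK => /eqP.
Qed.

(** Continuity at 0 with tolerance 1 gives a radius [d]; multiplying a unit vector by [d / 2] brings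
    it inside, whence the bound [2 / d]. *)
Lemma in_dual_unit_seq_bounded f : in_dual ab p f ->
  exists2 B, 0 <= B & forall j, ab (f (unit_seq j)) <= B.
Proof.
move=> [f_lin f_cont]; have l0 := lp0 abP p0.
have f0 := linear_on_lp0 f_lin.
have [d d0 hd] := f_cont _ l0 1 ltr01.
exists (2 / d); first by rewrite divr_ge0// ltW.
move=> j; have [lu nu] := unit_seq_lpn j.
have [ly ny] := lpZ abP p0 (emb (d / 2)) lu.
have d2 : 0 < d / 2 by rewrite divr_gt0.
have dist : lpn (Defs.seq_sub (seq_scale (emb (d / 2)) (unit_seq j)) (fun=> 0)) < d.
  have -> : Defs.seq_sub (seq_scale (emb (d / 2)) (unit_seq j)) (fun=> 0) =
      seq_scale (emb (d / 2)) (unit_seq j).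
    by apply/funext => k; rewrite /Defs.seq_sub subr0.
  rewrite ny nu (mod_emb abP) (gtr0_norm d2) mulr1 ltr_pdivrMr//.
  by rewrite ltr_pMr// ltr1n.
have fE : f (seq_scale (emb (d / 2)) (unit_seq j)) = emb (d / 2) * f (unit_seq j).
  rewrite -[RHS]addr0 -f0 -(f_lin _ _ _ lu l0); congr f.
  by apply/funext => k; rewrite /seq_add addr0.
have := hd _ ly dist; rewrite fE f0 subr0 (modM abP) (mod_emb abP) (gtr0_norm d2) => h.
by rewrite ler_pdivlMr// ltW//; move: h; rewrite mulrAC ltr_pdivrMr// mul1r mulrC.
Qed.

Variables (e : nat -> nat) (e_inj : injective e).

(** [w] times the indicator of [e 0, ..., e (N - 1)] when [e] is injective, built in the shape
    [a x + y] on which linearity is assumed. *)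
Fixpoint block (w : K) (N : nat) : nat -> K :=
  if N is N'.+1 then seq_add (seq_scale w (unit_seq (e N'))) (block w N')
  else fun=> 0.

Lemma block_outside w N k : (forall i, (i < N)%N -> k != e i) -> block w N k = 0.
Proof.
elim: N => [//|N IH] h /=; rewrite /seq_add /seq_scale /unit_seq.
rewrite (negbTE (h N (ltnSn N))) mulr0 add0r IH// => i iN.
by apply: h; rewrite ltnS ltnW.
Qed.

Lemma block_lp w N : lp (block w N) /\ psum ab p (block w N) = N%:R * ab w `^ p.
Proof.
elim: N => [|N [IH1 IH2]] /=.
  split; first exact: (lp0 abP p0).
  rewrite mul0r; apply/le_anti; rewrite psum_ge0 andbT.
  apply: (proj2 (psum_bounded (x := fun=> 0) _)) => n.
  by rewrite big1// => k _; rewrite (mod0 abP) powR0 ?gt_eqF.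
have [lu nu] := unit_seq_lpn (e N).
have [lw nw] := lpZ abP p0 w lu.
(* Injectivity of [e] makes the supports disjoint, so the [p]-th powers add exactly. *)
have E k : ab (seq_add (seq_scale w (unit_seq (e N))) (block w N) k) `^ p =
    ab (seq_scale w (unit_seq (e N)) k) `^ p + ab (block w N k) `^ p.
  rewrite /seq_add /seq_scale /unit_seq; have [->|ne] := eqVneq k (e N).
    rewrite block_outside => [|i iN].
      by rewrite addr0 (mod0 abP) (powR0 (lt0r_neq0 p0)) addr0.
    by apply/eqP => /e_inj EN; move: iN; rewrite EN ltnn.
  by rewrite mulr0 add0r (mod0 abP) (powR0 (lt0r_neq0 p0)) add0r.
have [h1 h2] := sumfinD (fun k => powR_ge0 _ p) (fun k => powR_ge0 _ p) lw IH1.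
split; first by rewrite /in_lp (funext E).
rewrite /psum (funext E) h2 -!/(psum ab p _) IH2 -(lpnX p0) nw nu mulr1.
by rewrite -natr1 mulrDl mul1r addrC.
Qed.

Lemma functional_block_le f B w N : linear_on_lp ab p f -> f (fun=> 0) = 0 ->
  (forall j, ab (f (unit_seq j)) <= B) ->
  ab (f (block w N)) <= N%:R * (ab w * B).
Proof.
move=> f_lin f0 hB; elim: N => [|N IH] /=; first by rewrite f0 (mod0 abP) mul0r.
rewrite f_lin; [|exact: (unit_seq_lpn _).1|exact: (block_lp _ _).1].
apply: le_trans (modD abP _ _) _; rewrite -natr1 mulrDl mul1r addrC lerD//.
by rewrite (modM abP) ler_wpM2l ?abs_ge0.
Qed.

Lemma diagonal_block (d : nat -> K) c w N : (forall i, d (e i) = c) ->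
  (fun k => d k * block w N k) = seq_scale c (block w N).
Proof.
move=> dc; apply/funext => k; elim: N => [|N IH] /=; first by rewrite /seq_scale !mulr0.
move: IH; rewrite /seq_scale /seq_add /unit_seq mulrDr => ->.
by have [->|_] := eqVneq k (e N); rewrite ?dc ?mulr0 ?mulrDr ?mulr0.
Qed.

Lemma diagonal_bounded_op (d : nat -> K) (D : R) : (forall k, ab (d k) <= D) ->
  bounded_op ab p (fun x k => d k * x k).
Proof.
move=> dD; have D0 : 0 <= D by exact: le_trans (abs_ge0 _) (dD 0%N).
have main x : lp x -> lp (fun k => d k * x k) /\ lpn (fun k => d k * x k) <= D * lpn x.
  move=> lx; have [l1 n1] := lpZ abP p0 (emb D) lx.
  have := lpn_mono abP p0 (x := fun k => d k * x k) l1.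
  rewrite n1 (mod_emb abP) (ger0_norm D0); apply => k.
  by rewrite /seq_scale !(modM abP) (mod_emb abP) (ger0_norm D0) ler_wpM2r ?abs_ge0.
split; first by move=> x /main[].
split; last by exists D => x /main[].
by move=> a x y _ _; apply/funext => k; rewrite /seq_add /seq_scale; ring.
Qed.

End BlockVectors.

(** * An almost disjoint family and its diagonal operators *)

Section Lineability.
Context {R : realType} {K : numFieldType} {ab : K -> R}
  {emb : {rmorphism R -> K}} (abP : is_modulus ab emb) {p : R} (p01 : 0 < p < 1).

Let p0 : 0 < p. Proof. by case/andP: p01. Qed.

(** Position [i] of the [n]-th block of [t]. Each block is infinite, so vectors with arbitrarily
    many entries fit into it. *)
Definition coord (t : R) (n i : nat) : nat := pickle (n, Num.floor (n%:R * t), i).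

(* The sets of [j] satisfying [mask t j], for [t] real, play the role of an
   almost disjoint family: for [s != t] they share no [coord t n i] with [n] large. *)
Definition mask (t : R) (j : nat) : bool :=
  if (unpickle j : option (nat * int * nat)) is Some (n, z, _)
  then z == Num.floor (n%:R * t) else false.

Lemma mask_coord s t n i :
  mask s (coord t n i) = (Num.floor (n%:R * t) == Num.floor (n%:R * s)).
Proof. by rewrite /mask /coord pickleK. Qed.

Lemma coord_inj t n : injective (coord t n).
Proof. by move=> i j /(pcan_inj pickleK)[]. Qed.

Definition mask_op (t : R) (x : nat -> K) : nat -> K :=
  fun j => if mask t j then x j else 0.

Definition symbol (S : seq R) (c : R -> K) (j : nat) : K :=
  \sum_(t <- S | mask t j) c t.

Lemma lincomb_mask_op S c x : lincomb mask_op S c x = fun j => symbol S c j * x j.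
Proof.
apply/funext => j; rewrite /lincomb /symbol mulr_suml [RHS]big_mkcond.
by apply: eq_bigr => t _; rewrite /mask_op; case: ifP; rewrite ?mulr0.
Qed.

(** Past some [n0] the blocks of [t] avoid the sets of all other members of the finite list [S], by
    [floor_multiples_differ], so only the coefficient of [t] remains. *)
Lemma symbol_coord S c t : uniq S -> t \in S ->
  exists n0, forall n, (n0 <= n)%N -> forall i, symbol S c (coord t n i) = c t.
Proof.
move=> uS tS.
have [n0 hn0] : exists n0, forall n, (n0 <= n)%N -> forall s, s \in S -> s != t ->
    Num.floor (n%:R * t) != Num.floor (n%:R * s).
  elim: S {uS tS} => [|s S [n1 IH]]; first by exists 0%N.
  have [st|st] := eqVneq s t.
    exists n1 => n /IH h u; rewrite inE => /predU1P[->|]; last exact: h.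
    by rewrite st eqxx.
  rewrite eq_sym in st; have [n2 h2] := floor_multiples_differ st.
  exists (maxn n1 n2) => n; rewrite geq_max => /andP[/IH h1 /h2 {}h2] u.
  by rewrite inE => /predU1P[->|]; [|exact: h1].
exists n0 => n /hn0 h i; rewrite /symbol big_mkcond (bigD1_seq t)//= mask_coord eqxx.
rewrite big1_seq ?addr0// => s /andP[st sS].
by rewrite mask_coord (negbTE (h s sS st)).
Qed.

Lemma symbol_le S c j : ab (symbol S c j) <= \sum_(t <- S) ab (c t).
Proof.
apply: le_trans (mod_sum abP _ _ _) _; rewrite big_mkcond; apply: ler_sum => t _.
by case: ifP => // _; exact: (mod_ge0 abP).
Qed.

(** The inequality says [N^(1 - p) >= 2^(n p)], so any [N] above [2^(n p / (1 - p))] works; this is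
    where [p < 1] enters. *)
Lemma large_block n : exists2 N : nat, (0 < N)%N & 1 <= N%:R * (N%:R * 2 ^+ n)^-1 `^ p :> R.
Proof.
have p10 : 0 < 1 - p by case/andP: p01 => _; lra.
have b0 : 0 <= (2 ^+ n : R) `^ (p / (1 - p)) by exact: powR_ge0.
have := archi_boundP b0; set N := Num.bound _ => hN; exists N.
  by rewrite -(ltr_nat R) (le_lt_trans b0).
have N0 : 0 < N%:R :> R by exact: le_lt_trans hN.
have t0 : 0 < 2 ^+ n :> R by rewrite exprn_gt0.
have h : (2 ^+ n) `^ p <= (N%:R : R) `^ (1 - p).
  have -> : (2 ^+ n : R) `^ p = ((2 ^+ n) `^ (p / (1 - p))) `^ (1 - p).
    by rewrite -powRrM divfK// gt_eqF.
  by apply: ge0_ler_powR; rewrite ?nnegrE ?ltW.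
have nt0 : 0 <= N%:R * 2 ^+ n :> R by rewrite mulr_ge0 ?(ltW N0) ?(ltW t0).
rewrite -(powR_inv1 nt0) -powRrM mulN1r powRN (powRM _ (ltW N0) (ltW t0)).
rewrite ler_pdivlMr ?mulr_gt0 ?powR_gt0// mul1r.
have eN : (N%:R : R) `^ p * N%:R `^ (1 - p) = N%:R.
  rewrite -powRD; first by rewrite addrC subrK powRr1// ltW.
  by rewrite (gt_eqF N0) implybT.
by rewrite -[leRHS]eN ler_pM2l ?powR_gt0.
Qed.

(** The witness [x n] has [N n] entries equal to [w n]. A functional takes on it a value of modulus
    at most [B / 2 ^+ n], whatever [N n] is, while for [n >= n0] the image is [c] times [x n], of
    quasi-norm at least [ab c]. *)
Lemma diagonal_not_summing (d : nat -> K) (e : nat -> nat -> nat) c n0 (r s : R) :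
  (forall n, injective (e n)) -> c != 0 ->
  (forall n, (n0 <= n)%N -> forall i, d (e n i) = c) -> 1 <= s -> s <= r ->
  ~ abs_summing ab p r s (fun x k => d k * x k).
Proof.
move=> e_inj c0 dc s1 sr summ.
have [N hN] : exists N : nat -> nat, forall n,
    (0 < N n)%N /\ 1 <= (N n)%:R * ((N n)%:R * 2 ^+ n)^-1 `^ p :> R.
  have big n : exists N : nat, (0 < N)%N /\ 1 <= N%:R * (N%:R * 2 ^+ n)^-1 `^ p :> R.
    by have [N N0 h] := large_block n; exists N.
  by have [N hN] := choice big; exists N.
pose w n : R := ((N n)%:R * 2 ^+ n)^-1.
have w0 n : 0 < w n.
  by rewrite invr_gt0 mulr_gt0 ?exprn_gt0// ltr0n; case: (hN n).
have abw n : ab (emb (w n)) = w n by rewrite (mod_emb abP) gtr0_norm.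
pose x n := block (e n) (emb (w n)) (N n).
have x_lp n : in_lp ab p (x n) := (block_lp abP p0 (e_inj n) _ _).1.
have x_large n : 1 <= lpnorm ab p (x n).
  rewrite leNgt; apply/negP => lt1.
  have := (hN n).2; rewrite leNgt => /negP; apply.
  rewrite -/(w n) -{1}abw -(block_lp abP p0 (e_inj n) _ _).2 -(lpnX p0) -/(x n).
  have pow1 : (1 : R) `^ p = 1 by rewrite powR1.
  rewrite -[ltRHS]pow1.
  by apply: gt0_ltr_powR; rewrite ?nnegrE ?lpn_ge0.
have cr : 0 < ab c `^ r by rewrite powR_gt0// (mod_gt0 abP).
apply: (sumfin_not_bounded_below (n0 := n0) _ cr _ (summ x x_lp _)) => [n|n nn0|f f_dual].
- exact: powR_ge0.
- rewrite (diagonal_block _ _ (dc n nn0)) (lpZ abP p0 c (x_lp n)).2.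
  have r0 : 0 <= r by apply: le_trans sr; apply: le_trans s1.
  apply: ge0_ler_powR; rewrite ?nnegrE ?mulr_ge0 ?(mod_ge0 abP) ?lpn_ge0//.
  by rewrite ler_peMr ?(mod_ge0 abP).
have [B B0 hB] := in_dual_unit_seq_bounded abP p0 f_dual.
have fx n : ab (f (x n)) <= B / 2 ^+ n.
  apply: le_trans (functional_block_le abP p0 (e_inj n) _ _ f_dual.1 _ hB) _.
    exact: (linear_on_lp0 abP p0 f_dual.1).
  rewrite abw /w invfM mulrA mulrA mulfV ?mul1r; first by rewrite mulrC.
  by rewrite pnatr_eq0 -lt0n; case: (hN n).
have s0 : 0 <= s by apply: le_trans s1.
apply: (proj1 (@tsum_bounded _ _ (B `^ s * 2) _ _)) => [n|n]; first exact: powR_ge0.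
apply: (@le_trans _ _ (\sum_(0 <= k < n) B `^ s * 2^-1 ^+ k)).
  apply: ler_sum => k _; apply: (@le_trans _ _ ((B * 2^-1 ^+ k) `^ s)).
    rewrite exprVn; apply: ge0_ler_powR; rewrite ?nnegrE ?(mod_ge0 abP)//.
    by rewrite mulr_ge0// invr_ge0 exprn_ge0.
  have h0 : 0 < (2^-1 : R) ^+ k by rewrite exprn_gt0 ?invr_gt0.
  rewrite powRM ?(ltW h0)// ler_wpM2l ?powR_ge0//.
  (* As [s >= 1], raising a number of [(0, 1]] to the power [s] does not increase it, and a
     geometric series remains. *)
  apply: ge1r_powR => //; rewrite h0 exprn_ile1 ?invr_ge0//.
  by rewrite invf_le1 ?ler1n.
rewrite -mulr_sumr ler_wpM2l ?powR_ge0//.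
suff -> : \sum_(0 <= k < n) (2^-1 : R) ^+ k = 2 - 2 * 2^-1 ^+ n.
  by rewrite gerBl mulr_ge0 ?exprn_ge0 ?invr_ge0.
elim: (n) => [|m IH]; first by rewrite big_nil expr0 mulr1 subrr.
by rewrite big_nat_recr//= IH exprS; field.
Qed.

Lemma c_lineable_nowhere_summing_lt1 : c_lineable_nowhere_summing ab p.
Proof.
exists mask_op => S c uS [t tS ct].
have [n0 hn0] := symbol_coord c uS tS.
split.
  (* On this unit vector the combination acts as the nonzero scalar [c t]. *)
  exists (unit_seq (coord t n0 0)); split; first exact: (unit_seq_lpn abP p0 _).1.
  exists (coord t n0 0).
  by rewrite lincomb_mask_op hn0// /unit_seq eqxx mulr1.
have -> : lincomb mask_op S c = fun x j => symbol S c j * x j.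
  by apply/funext => x; exact: lincomb_mask_op.
split; first exact: (diagonal_bounded_op abP p0 (symbol_le S c)).
by move=> r s; apply: (diagonal_not_summing (coord_inj (t := t)) ct hn0).
Qed.

End Lineability.

Theorem theorem3p1 (R : realType) :
  (forall p : R, 0 < p < 1 ->
     c_lineable_nowhere_summing (fun x : R => `|x|) p /\
     c_lineable_nowhere_summing (@cabs R) p) /\
  (forall p : R, 1 <= p ->
     every_op_summing (fun x : R => `|x|) p /\
     every_op_summing (@cabs R) p).
Proof.
split=> p hp; split.
- exact: c_lineable_nowhere_summing_lt1 (@real_modulus R) p hp.
- exact: c_lineable_nowhere_summing_lt1 (@complex_modulus R) p hp.
- exact: every_op_summing_ge1 (@real_modulus R) hp.
- exact: every_op_summing_ge1 (@complex_modulus R) hp.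
Qed.
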